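(* Let $n\ge 1$ be an integer and let $i=\lfloor \log_2 n\rfloor+1$ denote the number of digits in the standard binary representation of $n$. Then \[ f_{\mathrm{BSD}}(n,i+1)-f_{\mathrm{BSD}}(n,i)=\overline{f}_{\mathrm{BSD}}(n). \]
   Context: A binary signed-digit (BSD) representation of an integer $n$ is an expression $n=\sum_{j=0}^{\infty}\epsilon_j 2^j$ with every $\epsilon_j\in\{1,0,-1\}$ and only finitely many $\epsilon_j$ nonzero; representations are identified with their digit sequences $(\epsilon_j)_{j\ge 0}$ (so leading zeros are irrelevant). The leading term is $\epsilon_\ell 2^\ell$, where $\ell$ is the largest index with $\epsilon_\ell\ne 0$. A BSD representation is short if its leading two digits are neither $1,-1$ nor $-1,1$; that is, with $\ell$ the index of the leading term, it is not the case that $\ell\ge 1$ and $(\epsilon_\ell,\epsilon_{\ell-1})\in\{(1,-1),(-1,1)\}$. (A representation with $\ell=0$ is short.) $\overline{f}_{\mathrm{BSD}}(n)$ denotes the number of short BSD representations of $n$. For an integer $k\ge 1$, $f_{\mathrm{BSD}}(n,k)$ denotes the number of BSD representations of $n$ using exactly $k$ digits, that is, the number of tuples $(\epsilon_0,\dots,\epsilon_{k-1})\in\{1,0,-1\}^k$ with $n=\sum_{j=0}^{k-1}\epsilon_j 2^j$ (leading digits are allowed to be $0$, and there is no shortness requirement). *)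

(* Defs.v *)
From HB Require Import structures.
From mathcomp Require Import all_boot all_order all_algebra finmap.
From mathcomp Require Import mathcomp_extra boolp classical_sets functions cardinality.
From mathcomp Require Import zify.
Set Implicit Arguments.
Unset Strict Implicit.
Unset Printing Implicit Defensive.
Import Order.TTheory GRing.Theory Num.Theory.
Local Open Scope ring_scope.

Definition bsd_digit : finType := seq_sub [:: 1; 0; -1 : int].

Definition bsd_zero : bsd_digit := @SeqSub _ [:: 1; 0; -1 : int] 0 isT.

(* Digits are indexed from the least significant one; the leading digits may
   be 0. *)
Definition bsd_value_k (k : nat) (e : {ffun 'I_k -> bsd_digit}) : int :=
  \sum_(j < k) val (e j) * 2 ^+ j.

Definition f_BSD (n : int) (k : nat) : nat :=
  #|[set e : {ffun 'I_k -> bsd_digit} | bsd_value_k e == n]|.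

(* Finitely supported digit sequences, which identifies representations that
   differ only by leading zeros. *)
Definition bsd_seq := {fsfun nat -> bsd_digit with bsd_zero}.

Definition bsd_value (e : bsd_seq) : int :=
  \sum_(j <- finsupp e) val (e j) * 2 ^+ j.

(* The zero sequence has no leading term and gets index 0; it represents only
   the integer 0. *)
Definition lead_index (e : bsd_seq) : nat := \max_(j <- finsupp e) j.

Definition bsd_short (e : bsd_seq) : bool :=
  let l := lead_index e in
  ~~ ((0 < l)%N &&
      ((val (e l), val (e l.-1)) \in ([:: (1, -1); (-1, 1)] : seq (int * int)))).

Definition short_bsd_reps (n : int) : set bsd_seq :=
  [set e | bsd_value e = n /\ bsd_short e]%classic.

(* fset_set is the junk value fset0 on infinite sets; short_bsd_reps_finite
   below shows that this never occurs here. *)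
Definition fbar_BSD (n : int) : nat := #|` fset_set (short_bsd_reps n)|%fset.

Lemma bsd_digitP (d : bsd_digit) : [\/ val d = 1, val d = 0 | val d = -1].
Proof.
have := valP d; rewrite !inE => /or3P[] /eqP ->;
  [exact: Or31|exact: Or32|exact: Or33].
Qed.

Lemma bsd_value_lead (e : bsd_seq) :
  bsd_value e = \sum_(j < (lead_index e).+1) val (e j) * 2 ^+ j.
Proof.
rewrite /bsd_value -(big_mkord xpredT (fun j => val (e j) * 2 ^+ j)).
rewrite [RHS](bigID (fun j => j \in finsupp e)) /= [X in _ + X]big1 ?addr0.
  rewrite -[RHS]big_filter; apply/perm_big/uniq_perm; rewrite ?fset_uniq //.
    by rewrite filter_uniq ?iota_uniq.
  move=> j; rewrite mem_filter mem_index_iota /=.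
  case je: (j \in finsupp e) => //=.
  by rewrite ltnS; apply/esym/(leq_bigmax_seq (F := id)).
by move=> j /fsfun_dflt ->; rewrite mul0r.
Qed.

Lemma bsd_partial_bound (e : bsd_seq) (m : nat) :
  `|\sum_(j < m) val (e j) * 2 ^+ j| < 2 ^+ m :> int.
Proof.
elim: m => [|m IH]; first by rewrite big_ord0 normr0 expr0.
rewrite big_ord_recr /= exprS; have := IH.
set S := \sum_(_ < _) _; set P := 2 ^+ m.
by case: (bsd_digitP (e m)) => ->; lia.
Qed.

Lemma lead_index_neq0 (e : bsd_seq) :
  (0 < lead_index e)%N -> val (e (lead_index e)) != 0.
Proof.
move=> l0; have le : lead_index e \in finsupp e.
  move: l0; rewrite /lead_index big_seq.
  elim/big_ind: _ => // x y Hx Hy.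
  by rewrite /maxn; case: ifP.
by move: le; rewrite mem_finsupp; apply: contraNneq => h; apply/eqP/val_inj.
Qed.

Lemma lead_index_short (e : bsd_seq) :
  bsd_short e -> (lead_index e <= `|bsd_value e|)%N.
Proof.
rewrite /bsd_short bsd_value_lead; have := @lead_index_neq0 e.
case: (lead_index e) => [//|m] /(_ isT) /=.
rewrite !big_ord_recr /= exprS; have := bsd_partial_bound e m.
have : (m%:Z < 2 ^+ m).
  by rewrite -(natrX int 2 m) natz ltz_nat ltn_expl.
set S := \sum_(_ < _) _; set P := 2 ^+ m.
by case: (bsd_digitP (e m)) => ->; case: (bsd_digitP (e m.+1)) => -> //; lia.
Qed.

Lemma short_bsd_reps_finite (n : int) : finite_set (short_bsd_reps n).
Proof.
pose g (h : {ffun 'I_(`|n|.+1) -> bsd_digit}) : bsd_seq :=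
  [fsfun j in seq_fset tt (iota 0 `|n|.+1) => h (inord j) | bsd_zero].
apply: (@sub_finite_set _ _ (g @` setT)%classic);
  last exact/finite_image/finite_finset.
move=> e [en es]; exists [ffun j : 'I_(`|n|.+1) => e j] => //.
apply/fsfunP => j; rewrite fsfunE seq_fsetE mem_iota /= add0n.
case: ltnP => jn; first by rewrite ffunE inordK.
apply/esym/fsfun_dflt/negP => je; move: jn; apply/negP; rewrite -ltnNge ltnS.
apply: leq_trans (_ : lead_index e <= _)%N; first exact: (leq_bigmax_seq (F := id)).
by rewrite -en lead_index_short.
Qed.

(* Main.v *)
Require Import Defs.
From mathcomp Require Import all_boot all_order all_algebra.
From mathcomp Require Import finmap classical_sets cardinality zify.

(** Write i = t + 1, so that 2^t <= n < 2^(t+1).  Fixing the leading digit d of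
a representation of n with t + 2 digits leaves a representation of
n - d 2^(t+1) with t + 1 digits ([f_BSD_recr]).  The digit d = 0 accounts for
f_BSD n (t+1), and d = -1 is impossible because t + 1 digits only reach
integers below 2^(t+1) in absolute value ([f_BSD_eq0]).  The left-hand side is
thus the number of representations with t + 1 digits of n - 2^(t+1), that is,
of representations of n whose digit at t + 1 is 1, and it remains to put these
in bijection with the short representations of n ([fbar_BSD_recode]).

The lengths of short representations are controlled by their value: one with
positive value v and leading index l has 2^(l-1) < v < 2^(l+1), so that l is t
or t + 1 when v = n.  Conversely, among the representations of n with such a
leading index, those that are not short start with 1, -1 at t + 1 and t. Hence
the short representations of n are those whose digits at t + 1 and t are 1, 0
or 0, 1 ([short_top_digits]), while a representation of n with leading digit 1
at t + 1 starts with 1, 0 or 1, -1. Keeping 1, 0 and contracting 1, -1 to 0, 1,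
which preserves the value because 2^(t+1) - 2^t = 2^t, is the bijection
([recode]). *)

Set Implicit Arguments.
Unset Strict Implicit.
Unset Printing Implicit Defensive.
Import Order.TTheory GRing.Theory Num.Theory.
Local Open Scope ring_scope.

(** * Counting representations with a given number of digits *)

Lemma bsd_digit_eq0 (d : bsd_digit) : val d = 0 -> d = bsd_zero.
Proof. by move=> d0; apply: val_inj. Qed.

Lemma sum_bsd_digit (F : int -> nat) :
  (\sum_(d : bsd_digit) F (val d) = F 1%R + F 0%R + F (- 1)%R)%N.
Proof.
rewrite -(big_map val xpredT F) (perm_big [:: 1; 0; -1]) /=.
  by rewrite !big_cons big_nil addn0 addnA.
apply: uniq_perm => //.
  by rewrite map_inj_uniq ?index_enum_uniq //; apply: val_inj.
move=> x; apply/mapP/idP => [[d _ ->]|xD]; first exact: valP.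
by exists (SeqSub xD); rewrite ?mem_index_enum.
Qed.

Definition bsd_rcons (k : nat) (d : bsd_digit) (e : {ffun 'I_k -> bsd_digit}) :
    {ffun 'I_k.+1 -> bsd_digit} :=
  [ffun j => if unlift ord_max j is Some i then e i else d].

Lemma bsd_value_rcons k d (e : {ffun 'I_k -> bsd_digit}) :
  bsd_value_k (bsd_rcons d e) = bsd_value_k e + val d * 2 ^+ k.
Proof.
rewrite /bsd_value_k big_ord_recr /= ffunE unlift_none; congr (_ + _).
apply: eq_bigr => j _; rewrite ffunE.
have -> : widen_ord (leqnSn k) j = lift ord_max j.
  exact/val_inj/esym/lift_max.
by rewrite liftK.
Qed.

Lemma bsd_rcons_bij k :
  bijective (fun p : bsd_digit * {ffun 'I_k -> bsd_digit} => bsd_rcons p.1 p.2).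
Proof.
exists (fun e : {ffun 'I_k.+1 -> bsd_digit} =>
          (e ord_max, [ffun i => e (lift ord_max i)])) => [[d e]|e] /=.
  rewrite ffunE unlift_none; congr (_, _).
  by apply/ffunP => i; rewrite !ffunE liftK.
by apply/ffunP => j; rewrite ffunE; case: unliftP => [i|] ->; rewrite ?ffunE.
Qed.

(** The three terms are the choices 1, 0, -1 of the most significant digit. *)
Lemma f_BSD_recr (n : int) (k : nat) :
  (f_BSD n k.+1
     = f_BSD (n - 2 ^+ k)%R k + f_BSD n k + f_BSD (n + 2 ^+ k)%R k)%N.
Proof.
have fE m l : f_BSD m l
    = (\sum_(e : {ffun 'I_l -> bsd_digit}) (bsd_value_k e == m))%N.
  by rewrite /f_BSD cardsE -sum1_card big_mkcond.
transitivity (\sum_(d : bsd_digit) f_BSD (n - val d * 2 ^+ k)%R k)%N; last first.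
  rewrite (sum_bsd_digit (fun x => f_BSD (n - x * 2 ^+ k) k)).
  by rewrite mul1r mul0r subr0 mulN1r opprK.
rewrite fE (reindex _ (onW_bij _ (bsd_rcons_bij k))) /=.
under [RHS]eq_bigr do rewrite fE.
rewrite pair_big /=; apply: eq_bigr => -[d e] _ /=.
by rewrite bsd_value_rcons eq_sym -subr_eq eq_sym.
Qed.

(** Besides building sequences, truncation lets bounds on partial sums of
finitely supported sequences apply to arbitrary digit functions. *)
Definition bsd_trunc (k : nat) (u : nat -> bsd_digit) : bsd_seq :=
  [fsfun j in seq_fset tt (iota 0 k) => u j | bsd_zero].

Lemma bsd_truncE k u j :
  bsd_trunc k u j = if (j < k)%N then u j else bsd_zero.
Proof. by rewrite fsfunE seq_fsetE mem_iota. Qed.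

Lemma bsd_digits_bound (u : nat -> bsd_digit) (m : nat) :
  `|\sum_(j < m) val (u j) * 2 ^+ j| < 2 ^+ m :> int.
Proof.
have := bsd_partial_bound (bsd_trunc m u) m.
by under eq_bigr do rewrite bsd_truncE ltn_ord.
Qed.

Lemma bsd_value_k_inord k (e : {ffun 'I_k.+1 -> bsd_digit}) :
  bsd_value_k e = \sum_(j < k.+1) val (e (inord j)) * 2 ^+ j.
Proof. by apply: eq_bigr => j _; rewrite inord_val. Qed.

Lemma f_BSD_eq0 (n : int) (k : nat) : 2 ^+ k.+1 <= n -> f_BSD n k.+1 = 0%N.
Proof.
move=> kn; apply/eqP; rewrite cards_eq0; apply/eqP/setP => e; rewrite !inE.
rewrite bsd_value_k_inord; apply/negP => /eqP en.
by have := bsd_digits_bound (fun j => e (inord j)) k.+1; rewrite en; lia.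
Qed.

(** * The leading digits of short representations *)

Lemma bsd_above_lead (s : bsd_seq) j : (lead_index s < j)%N -> s j = bsd_zero.
Proof.
move=> lj; apply/fsfun_dflt/negP => js; move: lj; apply/negP; rewrite -leqNgt.
exact: (leq_bigmax_seq (F := id)).
Qed.

Lemma lead_indexP (s : bsd_seq) m :
  val (s m) != 0 -> (forall j, (m < j)%N -> s j = bsd_zero) -> lead_index s = m.
Proof.
move=> sm s0; case: (ltngtP (lead_index s) m) => // [lm|ml].
  by move: sm; rewrite bsd_above_lead.
by have := @lead_index_neq0 s (leq_ltn_trans (leq0n m) ml); rewrite s0.
Qed.

Lemma bsd_value_sum (s : bsd_seq) m :
  (forall j, (m <= j)%N -> s j = bsd_zero) ->
  bsd_value s = \sum_(j < m) val (s j) * 2 ^+ j.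
Proof.
move=> s0; have sumE k l :
    (k <= l)%N -> (forall j, (k <= j)%N -> s j = bsd_zero) ->
    \sum_(j < l) val (s j) * 2 ^+ j = \sum_(j < k) val (s j) * 2 ^+ j :> int.
  move=> kl sk; rewrite -!(big_mkord xpredT (fun j => val (s j) * 2 ^+ j)).
  rewrite (big_cat_nat (leq0n k) kl) /= -[RHS]addr0; congr (_ + _).
  rewrite big_nat_cond big1 //.
  by move=> j /andP[/andP[kj _] _]; rewrite sk ?mul0r.
rewrite bsd_value_lead; case: (leqP (lead_index s).+1 m) => [lm|ml].
  by rewrite (sumE _ _ lm) // => j /bsd_above_lead.
by rewrite (sumE _ _ (ltnW ml)).
Qed.

(** Without a second digit opposite to the first, cancellation cannot bring the
value down to half of the leading term; the sign of the value is then that of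
the leading digit. *)
Lemma short_lead_bounds (s : bsd_seq) (l := lead_index s) :
  bsd_short s -> 0 < bsd_value s ->
  [/\ val (s l) = 1, 2 ^+ l < 2 * bsd_value s & bsd_value s < 2 ^+ l.+1].
Proof.
rewrite /bsd_short {}/l bsd_value_lead; have := @lead_index_neq0 s.
case: (lead_index s) => [_ _|m] /=.
  rewrite big_ord_recr big_ord0 /=.
  by case: (bsd_digitP (s 0%N)) => ->.
move=> /(_ isT); rewrite !big_ord_recr /= !exprS.
have := bsd_digits_bound s m; set S := \sum_(_ < _) _; set P := 2 ^+ m.
by case: (bsd_digitP (s m)) => ->; case: (bsd_digitP (s m.+1)) => -> //;
  move=> *; split=> //; lia.
Qed.

(** The leading index of a short representation is [t] or [t.+1].  In the second
case a digit 1 at [t] would push the value above [2 ^+ t.+1], which leaves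
1, 0.  Conversely, if the digits at [t.+1] and [t] are 0, 1 then the digit below
cannot be -1, since the value would drop below [2 ^+ t]. *)
Lemma short_top_digits (s : bsd_seq) (t : nat) :
  2 ^+ t <= bsd_value s < 2 ^+ t.+1 ->
  bsd_short s <->
    (forall j, (t.+1 < j)%N -> s j = bsd_zero) /\ val (s t) + val (s t.+1) = 1.
Proof.
have P0 : 0 < 2 ^+ t :> int by rewrite exprn_gt0.
move=> /andP[tn nt]; split=> [sh|[s0 s1]].
  have n0 : 0 < bsd_value s by apply: lt_le_trans tn.
  have [l1 ln nl] := short_lead_bounds sh n0.
  have lt2 : (lead_index s <= t.+1)%N.
    rewrite -ltnS -(ltr_eXn2l (R := int) (x := 2)) //; apply: lt_trans ln _.
    by rewrite exprS ltr_pM2l.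
  have tl : (t <= lead_index s)%N.
    rewrite -ltnS -(ltr_eXn2l (R := int) (x := 2)) //.
    exact: le_lt_trans tn nl.
  have s0 j : (t.+1 < j)%N -> s j = bsd_zero.
    by move=> tj; apply: bsd_above_lead; lia.
  split=> //; case: (ltngtP (lead_index s) t) tl => // [tl _|le _]; last first.
    by rewrite -{1}le l1 bsd_above_lead // le.
  have lE : lead_index s = t.+1 by lia.
  move: sh l1 nt; rewrite /bsd_short bsd_value_lead lE !big_ord_recr /= exprS.
  have := bsd_digits_bound s t; set S := \sum_(_ < _) _; set P := 2 ^+ t.
  by case: (bsd_digitP (s t)) => ->; case: (bsd_digitP (s t.+1)) => -> //; lia.
move: tn nt; rewrite (@bsd_value_sum s t.+2) // !big_ord_recr /= exprS.
move: s1 => /=.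
case: (bsd_digitP (s t)) => st; case: (bsd_digitP (s t.+1)) => st1 //;
  rewrite st st1 // => _ tn _.
  have lE : lead_index s = t.
    apply: lead_indexP => [|j tj]; first by rewrite st.
    case: (ltngtP t.+1 j) tj => // [/s0 //|<- _].
    exact: bsd_digit_eq0.
  (* A digit -1 below the leading 1 would give a value less than [2 ^+ t]. *)
  rewrite /bsd_short lE st; case: t {lE P0 s0 st1} st tn => //= m _.
  rewrite big_ord_recr /= !exprS; have := bsd_digits_bound s m.
  set S := \sum_(_ < _) _; set P := 2 ^+ m.
  by case: (bsd_digitP (s m)) => -> //; lia.
have lE : lead_index s = t.+1 by apply: lead_indexP; rewrite ?st1.
by rewrite /bsd_short lE /= st st1.
Qed.

(** * Recoding the two leading digits *)

(** Only meaningful on 1, 0 and -1; other integers are sent to the digit 0. *)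
Definition bsd_digit_of (x : int) : bsd_digit :=
  insubd (bsd_zero : seq_sub [:: 1; 0; -1]) x.

Lemma bsd_digit_ofK (x : int) :
  x \in [:: 1; 0; -1] -> val (bsd_digit_of x) = x.
Proof. by move=> xD; rewrite /bsd_digit_of val_insubd xD. Qed.

Lemma bsd_digit_ofN (d : bsd_digit) : val (bsd_digit_of (- val d)) = - val d.
Proof. by apply: bsd_digit_ofK; case: (bsd_digitP d) => ->. Qed.

(** The argument represents [n - 2 ^+ t.+1], so that a digit 1 put in front of
it gives a representation of [n].  The two leading digits of the latter are 1, x
with x either 0 or -1, and become 1 + x, -x: the pair 1, 0 is kept and 1, -1 is
contracted to 0, 1. *)
Definition recode (t : nat) (e : {ffun 'I_t.+1 -> bsd_digit}) : bsd_seq :=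
  bsd_trunc t.+2 (fun j => if (j < t)%N then e (inord j)
    else if j == t then bsd_digit_of (- val (e ord_max))
    else bsd_digit_of (1 + val (e ord_max))).

Lemma recode_low t (e : {ffun 'I_t.+1 -> bsd_digit}) j :
  (j < t)%N -> recode e j = e (inord j).
Proof. by move=> jt; rewrite bsd_truncE jt ltnW // ltnW. Qed.

Lemma recode_mid t (e : {ffun 'I_t.+1 -> bsd_digit}) :
  val (recode e t) = - val (e ord_max).
Proof. by rewrite bsd_truncE ltnW // ltnn eqxx bsd_digit_ofN. Qed.

Lemma recode_top t (e : {ffun 'I_t.+1 -> bsd_digit}) :
  val (e ord_max) != 1 -> val (recode e t.+1) = 1 + val (e ord_max).
Proof.
rewrite bsd_truncE ltnSn ltnNge leqnSn /= gtn_eqF // => e1.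
by apply: bsd_digit_ofK; move: e1; case: (bsd_digitP (e ord_max)) => ->.
Qed.

Lemma recode_high t (e : {ffun 'I_t.+1 -> bsd_digit}) j :
  (t.+1 < j)%N -> recode e j = bsd_zero.
Proof. by move=> tj; rewrite bsd_truncE ltnNge tj. Qed.

(** With x the digit of [e] at [t], this is the identity
- x 2^t + (1 + x) 2^(t+1) = x 2^t + 2^(t+1). *)
Lemma bsd_value_recode t (e : {ffun 'I_t.+1 -> bsd_digit}) :
  val (e ord_max) != 1 -> bsd_value (recode e) = bsd_value_k e + 2 ^+ t.+1.
Proof.
move=> e1; rewrite (bsd_value_sum (@recode_high _ e)) /bsd_value_k.
rewrite !big_ord_recr /=.
rewrite recode_mid recode_top // -!addrA exprS.
congr (_ + _); last by case: (bsd_digitP (e ord_max)) => /= ->; lia.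
apply: eq_bigr => j _; rewrite recode_low //; congr (val (e _) * _).
by apply: val_inj; rewrite /= inordK // ltnW // ltnS.
Qed.

Lemma recode_inj t : injective (@recode t).
Proof.
move=> e e' /fsfunP eq_r; apply/ffunP => j.
have [jt|jt] : (j < t)%N \/ j = t :> nat by have := ltn_ord j; lia.
  by have := eq_r j; rewrite !recode_low ?inord_val.
have -> : j = ord_max by apply: val_inj.
by apply: val_inj; apply: oppr_inj; rewrite -!recode_mid eq_r.
Qed.

(** The digits at [t.+1] and [t] of a short representation of [n] are 1, 0 or
0, 1, which are exactly the pairs that recoding produces. *)
Lemma short_bsd_repsP (n : int) (t : nat) (s : bsd_seq) :
  2 ^+ t <= n < 2 ^+ t.+1 ->
  short_bsd_reps n s <->
    exists2 e : {ffun 'I_t.+1 -> bsd_digit},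
      bsd_value_k e = n - 2 ^+ t.+1 & s = recode e.
Proof.
move=> tn; split.
  move=> [sn sh].
  move: (tn); rewrite -sn => /short_top_digits/proj1/(_ sh)[s0 s1].
  (* The digit at [t] determines the one at [t.+1], so undoing the recoding
     amounts to negating the former and dropping the latter. *)
  pose e := [ffun j : 'I_t.+1 => if (j < t)%N then s j
                                 else bsd_digit_of (- val (s t))].
  have em : val (e ord_max) = - val (s t) by rewrite ffunE ltnn bsd_digit_ofN.
  have e1 : val (e ord_max) != 1.
    by rewrite em; move: s1; case: (bsd_digitP (s t)) => ->;
      case: (bsd_digitP (s t.+1)) => ->.
  have se : s = recode e.
    apply/fsfunP => j; case: (ltngtP j t) => [jt|tj|->].
    - by rewrite recode_low // ffunE inordK ?jt // ltnW.
    - case: (ltngtP t.+1 j) tj => // [tj _|<- _]; first by rewrite recode_high ?s0.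
      by apply: val_inj; rewrite recode_top // em; lia.
    - by apply: val_inj; rewrite recode_mid em opprK.
  by exists e; rewrite // se bsd_value_recode // addrK.
move=> [e en ->].
(* A leading 1 would make the value of [e] positive, but [n - 2 ^+ t.+1] is
   negative. *)
have e1 : val (e ord_max) != 1.
  apply/eqP => e1; move: en tn; rewrite bsd_value_k_inord big_ord_recr /=.
  have := bsd_digits_bound (fun j => e (inord j)) t.
  have -> : inord t = ord_max :> 'I_t.+1 by apply: val_inj; rewrite /= inordK.
  by rewrite e1 exprS; set S := \sum_(_ < _) _; lia.
have rn : bsd_value (recode e) = n by rewrite bsd_value_recode // en subrK.
split=> //; apply/(@short_top_digits _ t); rewrite ?rn //; split.
  exact: recode_high.
by rewrite recode_mid recode_top //; lia.
Qed.

Lemma fbar_BSD_recode (n : int) (t : nat) :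
  2 ^+ t <= n < 2 ^+ t.+1 -> fbar_BSD n = f_BSD (n - 2 ^+ t.+1) t.+1.
Proof.
move=> tn; rewrite /f_BSD; set E := finset _.
pose S := seq_fset tt [seq recode e | e <- enum E].
have memS s : s \in S <-> short_bsd_reps n s.
  rewrite seq_fsetE (short_bsd_repsP _ tn); split.
    by move=> /mapP[e]; rewrite mem_enum inE => /eqP en ->; exists e.
  by move=> [e en ->]; rewrite map_f // mem_enum inE en.
have SE : short_bsd_reps n = [set` S]%classic.
  by apply/seteqP; split=> s /memS.
rewrite /fbar_BSD SE set_fsetK size_seq_fset undup_id ?size_map -?cardE //.
by rewrite map_inj_uniq ?enum_uniq //; apply: recode_inj.
Qed.

Theorem theorem1p3 (n : nat) (hn : (1 <= n)%N) :
  let i := (trunc_log 2 n + 1)%N in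
  (f_BSD n%:Z (i + 1))%:Z - (f_BSD n%:Z i)%:Z = (fbar_BSD n%:Z)%:Z.
Proof.
move=> i; have /andP[tn nt] := @trunc_log_bounds 2 n isT hn.
have tnt : 2 ^+ trunc_log 2 n <= n%:Z < 2 ^+ (trunc_log 2 n).+1.
  by rewrite -!(natrX int 2) !natz lez_nat ltz_nat tn.
rewrite {}/i !addn1 f_BSD_recr (fbar_BSD_recode tnt).
rewrite (@f_BSD_eq0 (n%:Z + 2 ^+ _)); last by rewrite lerDr.
by rewrite addn0 PoszD addrK.
Qed.
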